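(* Let $A$ and $E$ be two finite subsets of $\mathbb{R}^n$ such that $Co^\infty(A)\cap Co^\infty(E)=\emptyset$. Then there exists a natural number $p_0$ such that: (a) for all $p\ge p_0$, $Co^p(A)\cap Co^p(E)=\emptyset$; (b) for all $p\ge p_0$ there exist $a^{(p)}\in\mathbb{R}^n\setminus\{0\}$ and $c_p\in\mathbb{R}$ such that $$Co^p(A)\subset\{x\in\mathbb{R}^n:\langle a^{(p)},x\rangle_p\le c_p\}\quad\text{and}\quad Co^p(E)\subset\{x\in\mathbb{R}^n:\langle a^{(p)},x\rangle_p\ge c_p\}.$$ Moreover: (c) there exist $a\in\mathbb{R}^n\setminus\{0\}$ and $c\in\mathbb{R}$ such that $$Co^\infty(A)\subset\{x\in\mathbb{R}^n:\langle a,x\rangle_\infty^-\le c\}\quad\text{and}\quad Co^\infty(E)\subset\{x\in\mathbb{R}^n:\langle a,x\rangle_\infty^+\ge c\}.$$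
   Context: Notation: $\mathbb{N}=\{0,1,2,\dots\}$. For $p\in\mathbb{N}$ let $\varphi_p(\lambda)=\lambda^{2p+1}$, a bijection of $\mathbb{R}$, and let $\phi_p:\mathbb{R}^n\to\mathbb{R}^n$ be its componentwise version. For a finite set $A\subset\mathbb{R}^n$, $Co^p(A)=\phi_p^{-1}\big(Co(\phi_p(A))\big)$, where $Co$ is the usual convex hull (so $Co^p(\emptyset)=\emptyset$). For a sequence of sets $A^{(p)}\subset\mathbb{R}^n$, $\mathrm{Ls}_{p\to\infty}A^{(p)}$ is the set of limits of convergent sequences $x^{(p_k)}\in A^{(p_k)}$ along subsequences $(p_k)$. Define $Co^\infty(A)=\mathrm{Ls}_{p\to\infty}Co^p(A)$. The $\varphi_p$-inner product is $\langle x,y\rangle_p=\varphi_p^{-1}\big(\langle\phi_p(x),\phi_p(y)\rangle\big)=\big(\sum_{i=1}^n(x_iy_i)^{2p+1}\big)^{1/(2p+1)}$. For real $u,v$, $u\stackrel{-}{\smile}v$ equals $u$ if $|u|>|v|$, $\min\{u,v\}$ if $|u|=|v|$, and $v$ if $|u|<|v|$ (this operation is associative). Put $\langle a,x\rangle_\infty^-=a_1x_1\stackrel{-}{\smile}\cdots\stackrel{-}{\smile}a_nx_n$ and $\langle a,x\rangle_\infty^+=-\langle a,-x\rangle_\infty^-$. *)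

(* Defs.v *)
From HB Require Import structures.
From mathcomp Require Export all_boot all_order all_algebra.
From mathcomp Require Export all_classical all_reals all_analysis.

Set Implicit Arguments.
Unset Strict Implicit.
Unset Printing Implicit Defensive.

Import Order.TTheory GRing.Theory Num.Theory.
Import numFieldNormedType.Exports.

Local Open Scope classical_set_scope.
Local Open Scope ring_scope.

Definition phi {R : realType} (p : nat) (t : R) : R := t ^+ (2 * p).+1.

(* The signed (2p+1)-th root; the library's real power `^ is only meaningful
   on nonnegative bases. *)
Definition phi_inv {R : realType} (p : nat) (t : R) : R :=
  Num.sg t * `|t| `^ ((2 * p).+1%:R^-1).

Lemma phi_inv_ge0 (R : realType) p (t : R) : 0 <= t ->
  phi_inv p t = t `^ ((2 * p).+1%:R^-1).
Proof.
rewrite /phi_inv le_eqVlt => /predU1P[<-|t0].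
  by rewrite sgr0 mul0r powR0// invr_eq0 pnatr_eq0.
by rewrite gtr0_sg// mul1r gtr0_norm.
Qed.

Lemma phiN (R : realType) p (t : R) : phi p (- t) = - phi p t.
Proof. by rewrite /phi exprNn -signr_odd /= mul2n odd_double expr1 mulN1r. Qed.

Lemma phi_invN (R : realType) p (t : R) : phi_inv p (- t) = - phi_inv p t.
Proof. by rewrite /phi_inv sgrN normrN mulNr. Qed.

Lemma phiK (R : realType) p : cancel (@phi R p) (phi_inv p).
Proof.
have K0 (t : R) : 0 <= t -> phi_inv p (phi p t) = t.
  move=> t0; rewrite phi_inv_ge0 ?exprn_ge0// /phi -powR_mulrn// -powRrM.
  by rewrite divff ?pnatr_eq0// powRr1.
move=> t; have [/K0//|t0] := leP 0 t.
by apply: oppr_inj; rewrite -phi_invN -phiN K0// oppr_ge0 ltW.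
Qed.

Lemma phi_invK (R : realType) p : cancel (@phi_inv R p) (phi p).
Proof.
have K0 (t : R) : 0 <= t -> phi p (phi_inv p t) = t.
  move=> t0; rewrite phi_inv_ge0// /phi -powR_mulrn ?powR_ge0// -powRrM.
  by rewrite mulVf ?pnatr_eq0// powRr1.
move=> t; have [/K0//|t0] := leP 0 t.
by apply: oppr_inj; rewrite -phiN -phi_invN K0// oppr_ge0 ltW.
Qed.

Definition phin {R : realType} {n : nat} (p : nat) (x : 'rV[R]_n) : 'rV[R]_n :=
  map_mx (phi p) x.

Definition conv_hull {R : realType} {n : nat} (A : set 'rV[R]_n) :
    set 'rV[R]_n :=
  smallest (@convex_set R 'rV[R]_n) A.

Definition Cop {R : realType} {n : nat} (p : nat) (A : set 'rV[R]_n) :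
    set 'rV[R]_n :=
  phin p @^-1` (conv_hull (phin p @` A)).

(* The Kuratowski upper limit; the subsequence starts at an arbitrary index,
   so empty terms are skipped. *)
Definition Ls {R : realType} {n : nat} (A : nat -> set 'rV[R]_n) :
    set 'rV[R]_n :=
  [set x | exists (k : nat -> nat) (u : nat -> 'rV[R]_n),
     [/\ increasing_seq k, forall m, A (k m) (u m) & u @ \oo --> x]].

Definition Coinfty {R : realType} {n : nat} (A : set 'rV[R]_n) :
    set 'rV[R]_n :=
  Ls (fun p => Cop p A).

Definition inner_p {R : realType} {n : nat} (p : nat) (x y : 'rV[R]_n) : R :=
  phi_inv p (\sum_(i < n) phin p x 0 i * phin p y 0 i).

Lemma inner_pE (R : realType) (n p : nat) (x y : 'rV[R]_n) :
  inner_p p x y = phi_inv p (\sum_(i < n) (x 0 i * y 0 i) ^+ (2 * p).+1).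
Proof.
by congr phi_inv; apply: eq_bigr => i _; rewrite !mxE /phi exprMn.
Qed.

Definition smile {R : realType} (u v : R) : R :=
  if `|u| > `|v| then u else if `|u| == `|v| then Num.min u v else v.

Lemma smileC (R : realType) : commutative (@smile R).
Proof.
move=> u v; rewrite /smile.
by case: (ltgtP `|u| `|v|) => // _; rewrite minC.
Qed.

Lemma smile0r (R : realType) : left_id 0 (@smile R).
Proof.
move=> u; rewrite /smile normr0 normr_lt0; case: eqP => // /esym/eqP.
by rewrite normr_eq0 => /eqP ->; rewrite minxx.
Qed.

Lemma smileA (R : realType) : associative (@smile R).
Proof.
pose r (x y : R) := (`|y| < `|x|) || ((`|x| == `|y|) && (x <= y)).
have smileE (x y : R) : smile x y = if r x y then x else y.
  rewrite /smile /r; case: (ltgtP `|x| `|y|) => //= _.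
  by rewrite /Num.min; case: ltgtP.
have r_total : total r.
  by move=> x y; rewrite /r; case: (ltgtP `|x| `|y|) => //= _; exact: le_total.
have r_trans : transitive r.
  move=> y x z /orP[yx|/andP[/eqP xy xley]] /orP[zy|/andP[/eqP yz ylez]].
  - by rewrite /r (lt_trans zy yx).
  - by rewrite /r -yz yx.
  - by rewrite /r xy zy.
  - by rewrite /r xy yz eqxx (le_trans xley ylez) orbT.
move=> u v w; rewrite !smileE.
have [vw|vw] := boolP (r v w); have [uv|uv] := boolP (r u v).
- by rewrite (r_trans _ _ _ uv vw).
- by rewrite vw.
- by [].
- rewrite (negbTE vw); case: ifP => // uw; case/negP: uv.
  by apply: r_trans uw _; have := r_total v w; rewrite (negbTE vw).
Qed.

HB.instance Definition _ (R : realType) :=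
  Monoid.isComLaw.Build R 0 (@smile R) (@smileA R) (@smileC R) (@smile0r R).

(* 0 is neutral for smile, so the initial value of the fold is harmless. *)
Definition inner_minus {R : realType} {n : nat} (a x : 'rV[R]_n) : R :=
  \big[smile/0]_(i < n) (a 0 i * x 0 i).

Definition inner_plus {R : realType} {n : nat} (a x : 'rV[R]_n) : R :=
  - inner_minus a (- x).

(* Main.v *)
Require Import Defs.
From mathcomp Require Import ring lra.
Import Order.TTheory GRing.Theory Num.Theory.
Import numFieldNormedType.Exports.
Local Open Scope classical_set_scope.
Local Open Scope ring_scope.

(** Why the theorem holds. Separating the polytopes [Co(phi_p(A))] and
    [Co(phi_p(E))] for each [p] separately is classical; the difficulty is the
    limit. A point of [Coinfty A] may be approached along one subsequence of
    exponents and a point of [Coinfty E] along another, so a compactness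
    argument that extracts a convergent subsequence of separating hyperplanes
    says nothing about all of [Coinfty A]. The hyperplanes have to be chosen
    so that they converge along the full sequence of exponents.

    This is achieved by solving the separation problem for all [p] at once,
    with [p] treated as an indeterminate. The coordinates of the points of
    [phi_p(A)] and [phi_p(E)] are, as functions of [p], exponential sums
    [sum_j c_j * g_j ^ p] with [g_j >= 0]. These form a ring, and the term with
    the largest base decides the sign, so that each of them is eventually
    positive or eventually nonpositive ([expsum_gt0_or_le0]): their germs at
    infinity behave like an ordered ring. Gordan's theorem of the alternative
    holds over it ([gordan_expsum]): either the two hulls meet for all large
    [p], or there is a normal vector [a] whose entries are exponential sums and
    which strictly separates them for all large [p]. In the first case common
    points accumulate, by Bolzano-Weierstrass, at a common point of [Coinfty A]
    and [Coinfty E] ([Coinfty_meet]), which is excluded.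

    In the second case [a] is divided by the largest modulus [d] of its entries. The
    numbers [phi_inv p (f p / d p)], for an exponential sum [f], converge
    without any asymptotic computation: comparing them with a constant [M]
    means looking at the sign of the exponential sum [f - phi_p(M) * d], so they
    are eventually on one side of every constant, and a bounded sequence with
    this property converges ([comparable_bounded_cvg]). This applies to the
    entries of the normal vectors and to the thresholds [c_p]. The limit normal
    is nonzero because one of its entries stays equal to 1 or -1. Finally
    [inner_minus] is a lower bound of the limits of the inner products
    ([inner_minus_lt_lim]), so that the inequalities for finite [p] pass to the
    limit along every subsequence. *)

Set Implicit Arguments.
Unset Strict Implicit.
Unset Printing Implicit Defensive.

(** * Exponential sums *)

Definition expsum (R : realType) (f : nat -> R) : Prop :=
  exists s : seq (R * R), (forall z, z \in s -> 0 <= z.2) /\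
    forall p, f p = \sum_(z <- s) z.1 * z.2 ^+ p.

Lemma expsum_cst (R : realType) (c : R) : expsum (fun=> c).
Proof.
exists [:: (c, 1)]; split=> [z|p]; first by rewrite inE => /eqP ->.
by rewrite big_seq1 expr1n mulr1.
Qed.

Lemma expsumD (R : realType) (f g : nat -> R) :
  expsum f -> expsum g -> expsum (fun p => f p + g p).
Proof.
move=> [s [s0 fE]] [t [t0 gE]]; exists (s ++ t); split=> [z|p].
  by rewrite mem_cat => /orP[/s0|/t0].
by rewrite big_cat fE gE.
Qed.

Lemma expsumM (R : realType) (f g : nat -> R) :
  expsum f -> expsum g -> expsum (fun p => f p * g p).
Proof.
move=> [s [s0 fE]] [t [t0 gE]].
exists [seq (x.1 * y.1, x.2 * y.2) | x <- s, y <- t]; split=> [z|p].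
  by case/allpairsP => -[x y] [/s0 ? /t0 ? ->]; exact: mulr_ge0.
rewrite fE gE big_allpairs_dep mulr_suml; apply: eq_bigr => x _.
rewrite mulr_sumr; apply: eq_bigr => y _ /=.
by rewrite exprMn; ring.
Qed.

Lemma expsumN (R : realType) (f : nat -> R) :
  expsum f -> expsum (fun p => - f p).
Proof.
move=> ef; have := expsumM (expsum_cst (-1)) ef.
by congr expsum; apply/funext => p; rewrite mulN1r.
Qed.

Lemma expsumB (R : realType) (f g : nat -> R) :
  expsum f -> expsum g -> expsum (fun p => f p - g p).
Proof. by move=> ef eg; exact: expsumD ef (expsumN eg). Qed.

Lemma expsum_sum (R : realType) (n : nat) (f : 'I_n -> nat -> R) :
  (forall i, expsum (f i)) -> expsum (fun p => \sum_i f i p).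
Proof.
move=> ef; elim: (index_enum _) => [|i r ih].
  have := expsum_cst (0 : R); congr expsum.
  by apply/funext => p; rewrite big_nil.
have := expsumD (ef i) ih; congr expsum.
by apply/funext => p; rewrite big_cons.
Qed.

(** The exponent being [2 p + 1], the function is [b * (b ^ 2) ^ p]: its base is
    nonnegative whatever the sign of [b], which is why [expsum] can ask for
    nonnegative bases without losing the coordinates of [phi_p]. *)
Lemma expsum_phi (R : realType) (b : R) : expsum (fun p => phi p b).
Proof.
exists [:: (b, b ^+ 2)]; split=> [z|p].
  by rewrite inE => /eqP ->; exact: sqr_ge0.
by rewrite big_seq1 /phi exprS exprM.
Qed.

Lemma cvg_sum_seq (R : realType) (I : eqType) (r : seq I) (f : I -> nat -> R)
  (l : I -> R) : (forall i, i \in r -> f i @ \oo --> l i) ->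
  (fun p => \sum_(i <- r) f i p) @ \oo --> \sum_(i <- r) l i.
Proof.
elim: r => [|i r ih] fl.
  rewrite big_nil; under eq_fun do rewrite big_nil; exact: cvg_cst.
rewrite big_cons; under eq_fun do rewrite big_cons; apply: cvgD.
  by apply: fl; rewrite mem_head.
by apply: ih => j jr; apply: fl; rewrite inE jr orbT.
Qed.

Lemma total_preorder_max (I : eqType) (le : I -> I -> Prop) (r : seq I) :
  (forall i j, le i j \/ le j i) ->
  (forall j i k, le i j -> le j k -> le i k) ->
  r != [::] -> exists2 i, i \in r & forall j, j \in r -> le j i.
Proof.
move=> le_total le_trans; have le_refl i : le i i by case: (le_total i i).
elim: r => // i r ih _; have [->|/ih [m mr m_max]] := eqVneq r [::].
  by exists i => [|j]; rewrite inE // => /eqP ->.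
case: (le_total i m) => [im|mi].
  by exists m => [|j]; rewrite inE ?mr ?orbT// => /predU1P[->|/m_max].
exists i; rewrite ?mem_head// => j; rewrite inE => /predU1P[->//|/m_max jm].
exact: le_trans jm mi.
Qed.

(** The terms with the largest base [g] are grouped into [C * g ^ p]. If [C = 0],
    a shorter sum remains; otherwise the sum divided by [g ^ p] tends to [C].
    Applied to a difference, this compares any two exponential sums for
    large [p]. *)
Lemma expsum_gt0_or_le0 (R : realType) (f : nat -> R) : expsum f ->
  (\forall p \near \oo, 0 < f p) \/ (\forall p \near \oo, f p <= 0).
Proof.
move=> [s [s0 fE]].
elim: {s}(size s) {-2}s (leqnn (size s)) f s0 fE => [|k ih] s ssz f s0 fE.
  right; apply: nearW => p; rewrite fE.
  by move: ssz; rewrite leqn0 size_eq0 => /eqP ->; rewrite big_nil.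
have [s_nil|s_pos] := eqVneq s [::].
  by right; apply: nearW => p; rewrite fE s_nil big_nil.
have [z0 z0s g_ge] : exists2 z0, z0 \in s & forall z, z \in s -> z.2 <= z0.2.
  apply: (@total_preorder_max _ (fun z z' => z.2 <= z'.2)) => //.
    by move=> z z'; apply/orP/le_total.
  by move=> z z' z''; exact: le_trans.
pose g := z0.2; have g0 : 0 <= g by exact: s0.
have fE2 p : f p = (\sum_(z <- s | z.2 == g) z.1) * g ^+ p
    + \sum_(z <- [seq z <- s | z.2 != g]) z.1 * z.2 ^+ p.
  rewrite fE (bigID (fun z => z.2 == g)) /= big_filter; congr (_ + _).
  by rewrite mulr_suml; apply: eq_bigr => z /eqP ->.
set t := [seq z <- s | z.2 != g] in fE2.
set C := \sum_(z <- s | _) _ in fE2.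
have t0 z : z \in t -> 0 <= z.2 by rewrite mem_filter => /andP[_ /s0].
have tsz : (size t <= k)%N.
  rewrite -ltnS (leq_trans _ ssz)// size_filter -(count_predC (fun z => z.2 == g) s).
  rewrite -[ltnLHS]add0n -addSn leq_add2r -has_count; apply/hasP.
  by by exists z0.
have [C0|C0] := eqVneq C 0.
  by apply: (ih t) => // p; rewrite fE2 C0 mul0r add0r.
(* When all bases vanish, only the value at p = 0 can be nonzero. *)
move: g0; rewrite le_eqVlt => /predU1P[gE|g_gt0].
  right; near=> p; rewrite fE big1_seq// => z /andP[_ zs].
  have -> : z.2 = 0 by apply/eqP; rewrite eq_le s0// andbT gE g_ge.
  rewrite expr0n; suff -> : p == 0 = false by rewrite mulr0.
  by apply/negbTE; rewrite -lt0n; near: p; exists 1.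
have fgC : (fun p => f p / g ^+ p) @ \oo --> C.
  have -> : (fun p => f p / g ^+ p) =
      (fun p => C + \sum_(z <- t) z.1 * (z.2 / g) ^+ p).
    apply/funext => p; rewrite fE2 mulrDl mulfK ?expf_neq0 ?gt_eqF//.
    by rewrite mulr_suml; congr (_ + _); apply: eq_bigr => z _; rewrite expr_div_n mulrA.
  rewrite -[X in _ --> X]addr0; apply: cvgD; first exact: cvg_cst.
  rewrite [X in _ --> X](_ : 0 = \sum_(z <- t) 0); last by rewrite big1.
  apply: cvg_sum_seq => z; rewrite mem_filter => /andP[zg zs].
  rewrite -(mulr0 z.1); apply: cvgM; first exact: cvg_cst.
  apply: cvg_expr; rewrite ger0_norm; last by rewrite divr_ge0 ?s0// ltW.
  by rewrite ltr_pdivrMr// mul1r lt_neqAle zg g_ge.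
have pos p : 0 < g ^+ p by exact: exprn_gt0.
case: (ltgtP C 0) => [Cn|Cp|/eqP]; last by rewrite (negbTE C0).
  right; apply: filterS (cvgr_le _ fgC _ Cn) => p.
  by rewrite pmulr_lle0 ?invr_gt0.
left; apply: filterS (cvgr_gt _ fgC _ Cp) => p.
by rewrite pmulr_lgt0 ?invr_gt0.
Unshelve. all: by end_near.
Qed.

(** * Gordan's alternative over exponential sums *)

Definition dotrow (R : realType) (n : nat) (x y : 'rV[R]_n) : R :=
  \sum_i x 0 i * y 0 i.

Lemma dotrowC (R : realType) n (x y : 'rV[R]_n) : dotrow x y = dotrow y x.
Proof. by apply: eq_bigr => i _; rewrite mulrC. Qed.

Lemma dotrowDr (R : realType) n (x y z : 'rV[R]_n) :
  dotrow x (y + z) = dotrow x y + dotrow x z.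
Proof. by rewrite -big_split; apply: eq_bigr => i _; rewrite mxE mulrDr. Qed.

Lemma dotrowZr (R : realType) n (x y : 'rV[R]_n) (c : R) :
  dotrow x (c *: y) = c * dotrow x y.
Proof. by rewrite mulr_sumr; apply: eq_bigr => i _; rewrite mxE mulrCA. Qed.

Lemma dotrowBr (R : realType) n (x y z : 'rV[R]_n) :
  dotrow x (y - z) = dotrow x y - dotrow x z.
Proof. by rewrite dotrowDr -scaleN1r dotrowZr mulN1r. Qed.

Lemma dotrowDl (R : realType) n (x y z : 'rV[R]_n) :
  dotrow (y + z) x = dotrow y x + dotrow z x.
Proof. by rewrite !(dotrowC _ x) dotrowDr. Qed.

Lemma dotrowBl (R : realType) n (x y z : 'rV[R]_n) :
  dotrow (y - z) x = dotrow y x - dotrow z x.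
Proof. by rewrite !(dotrowC _ x) dotrowBr. Qed.

Lemma dotrowZl (R : realType) n (x y : 'rV[R]_n) (c : R) :
  dotrow (c *: y) x = c * dotrow y x.
Proof. by rewrite !(dotrowC _ x) dotrowZr. Qed.

Lemma dotrow_le0 (R : realType) n (x : 'rV[R]_n) : dotrow x x <= 0 -> x = 0.
Proof.
move=> x0; have sq0 i : true -> 0 <= x 0 i * x 0 i.
  by rewrite -expr2 sqr_ge0.
have /eqP : dotrow x x = 0 by apply/eqP; rewrite eq_le x0 sumr_ge0.
rewrite psumr_eq0// => /allP x2; apply/rowP => i; rewrite mxE.
by have := x2 i (mem_index_enum i); rewrite mulf_eq0 orbb => /eqP.
Qed.

Definition expsum_row (R : realType) (n : nat) (v : nat -> 'rV[R]_n) : Prop :=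
  forall i, expsum (fun p => v p 0 i).

Lemma expsum_dotrow (R : realType) n (u v : nat -> 'rV[R]_n) :
  expsum_row u -> expsum_row v -> expsum (fun p => dotrow (u p) (v p)).
Proof. by move=> eu ev; apply: expsum_sum => i; exact: expsumM. Qed.

Lemma expsum_rowB (R : realType) n (u v : nat -> 'rV[R]_n) :
  expsum_row u -> expsum_row v -> expsum_row (fun p => u p - v p).
Proof.
move=> eu ev i; have := expsumB (eu i) (ev i); congr expsum.
by apply/funext => p; rewrite !mxE.
Qed.

Lemma expsum_rowD (R : realType) n (u v : nat -> 'rV[R]_n) :
  expsum_row u -> expsum_row v -> expsum_row (fun p => u p + v p).
Proof.
move=> eu ev i; have := expsumD (eu i) (ev i); congr expsum.
by apply/funext => p; rewrite !mxE.
Qed.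

Lemma expsum_rowZ (R : realType) n (c : nat -> R) (v : nat -> 'rV[R]_n) :
  expsum c -> expsum_row v -> expsum_row (fun p => c p *: v p).
Proof.
move=> ec ev i; have := expsumM ec (ev i); congr expsum.
by apply/funext => p; rewrite !mxE.
Qed.

Lemma near_forall_seq (T : Type) (F : set_system T) (FF : Filter F)
  (I : eqType) (r : seq I) (P : I -> T -> Prop) :
  (forall i, i \in r -> \forall x \near F, P i x) ->
  \forall x \near F, forall i, i \in r -> P i x.
Proof.
elim: r => [|j r ih] Pr; first exact: nearW.
have Pj := Pr j (mem_head _ _).
have {}ih : \forall x \near F, forall i, i \in r -> P i x.
  by apply: ih => i ir; apply: Pr; rewrite inE ir orbT.
by apply: filterS2 Pj ih => x Pj Pr' i; rewrite inE => /predU1P[->|/Pr'].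
Qed.

(** A substitute for choosing a large constant: germs of exponential sums are not
    archimedean, so the ratio [M / L] that makes every [M * d i + L * e i] positive
    is built from them, going through the list: it starts from 0 and is replaced by
    [1 - e j / d j], written without division, when it is too small for [j]. *)
Lemma expsum_scale_dominate (R : realType) (I : eqType) (r : seq I)
  (d e : I -> nat -> R) :
  (forall i, i \in r -> expsum (d i) /\ \forall p \near \oo, 0 < d i p) ->
  (forall i, i \in r -> expsum (e i)) ->
  exists M L : nat -> R, [/\ expsum M, expsum L, \forall p \near \oo, 0 < L p &
    forall i, i \in r -> \forall p \near \oo, 0 < M p * d i p + L p * e i p].
Proof.
elim: r => [|j r ih] dr er.
  exists (fun=> 0), (fun=> 1); split => //; try exact: expsum_cst.
  exact: nearW.
have [||M [L [eM eL L0 ML]]] := ih.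
- by move=> i ir; apply: dr; rewrite inE ir orbT.
- by move=> i ir; apply: er; rewrite inE ir orbT.
have [dj dj0] := dr j (mem_head _ _); have ej := er j (mem_head _ _).
have [MLj|MLj] := expsum_gt0_or_le0 (expsumD (expsumM eM dj) (expsumM eL ej)).
  by exists M, L; split => // i; rewrite inE => /predU1P[->|/ML].
exists (fun p => d j p - e j p), (d j); split => //; first exact: expsumB.
move=> i; rewrite inE => /predU1P[->|ir].
  by apply: filterS dj0 => p d0; rewrite mulrC -mulrDr subrK mulr_gt0.
have ijr : i \in j :: r by rewrite inE ir orbT.
have [_ di0] := dr i ijr.
near=> p.
have L_gt0 : 0 < L p by near: p.
have dj_gt0 : 0 < d j p by near: p.
have di_gt0 : 0 < d i p by near: p.
have MLi : 0 < M p * d i p + L p * e i p by near: p; exact: ML.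
rewrite -(pmulr_rgt0 _ L_gt0).
have MLj_le0 : M p * d j p + L p * e j p <= 0 by near: p.
have := mulr_gt0 (mulr_gt0 L_gt0 dj_gt0) di_gt0.
have := mulr_gt0 dj_gt0 MLi.
have : 0 <= - (M p * d j p + L p * e j p) * d i p.
  by rewrite mulr_ge0 ?oppr_ge0// ltW.
nra.
Unshelve. all: by end_near. Qed.

Definition cone (R : realType) (n : nat) (C : set 'rV[R]_n) : Prop :=
  (forall x y, C x -> C y -> C (x + y)) /\
  (forall (t : R) x, 0 < t -> C x -> C (t *: x)).

(** The second alternative is a vanishing nonnegative combination of the vectors,
    not all of whose coefficients are zero; quantifying over cones says this
    without naming coefficients.

    Induction on the vectors, [w] being the new one. Let [a] be positive on the
    others. If it is not positive on [w], the vectors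
    [u i = <a, v i> w - <a, w> v i] are conic combinations of [w] and [v i], lying
    in the hyperplane orthogonal to [a], and the induction hypothesis applies to
    them: a relation between the [u i] is one between [w] and the [v i], while a
    vector [b] positive on the [u i] gives [a1 = <b, w> a - <a, w> b], positive on
    the [v i] and zero on [w]. Adding a small multiple of [w] to [a1] makes it
    positive on [w] too. *)
Lemma gordan_expsum (R : realType) (n : nat) (I : eqType) (r : seq I)
  (v : I -> nat -> 'rV[R]_n) : (forall i, i \in r -> expsum_row (v i)) ->
  (exists a, expsum_row a /\
     forall i, i \in r -> \forall p \near \oo, 0 < dotrow (a p) (v i p)) \/
  (\forall p \near \oo, forall C, cone C ->
     (forall i, i \in r -> C (v i p)) -> C 0).
Proof.
elim: r v => [|j r ih] v ev.
  left; exists (fun=> 0); split => // i; have := expsum_cst (0 : R).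
  by congr expsum; apply/funext => p; rewrite mxE.
have ew := ev j (mem_head _ _); set w := v j in ew.
have {}ev i : i \in r -> expsum_row (v i).
  by move=> ir; apply: ev; rewrite inE ir orbT.
have [ww|ww] := expsum_gt0_or_le0 (expsum_dotrow ew ew); last first.
  right; apply: filterS ww => p /dotrow_le0 w0 C _ /(_ j (mem_head _ _)).
  by rewrite -/w w0.
have [[a [ea a_gt0]]|C0] := ih v ev; last first.
  right; apply: filterS C0 => p + C coneC Cv; apply=> // i ir.
  by apply: Cv; rewrite inE ir orbT.
have eaw := expsum_dotrow ea ew.
have [aw|aw] := expsum_gt0_or_le0 eaw.
  by left; exists a; split => // i; rewrite inE => /predU1P[->|/a_gt0].
pose u i p := dotrow (a p) (v i p) *: w p - dotrow (a p) (w p) *: v i p.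
have eu i : i \in r -> expsum_row (u i).
  move=> /ev evi; apply: expsum_rowB; apply: expsum_rowZ => //.
  exact: expsum_dotrow.
have [[b [eb b_gt0]]|C0] := ih u eu; last first.
  right; near=> p => C [CD CZ] Cv.
  have aw_le0 : dotrow (a p) (w p) <= 0 by near: p.
  have C0p : forall C, cone C -> (forall i, i \in r -> C (u i p)) -> C 0.
    by near: p.
  have av : forall i, i \in r -> 0 < dotrow (a p) (v i p).
    by near: p; exact: near_forall_seq.
  apply: C0p => // i ir; rewrite /u.
  have Cw : C (dotrow (a p) (v i p) *: w p).
    by apply: CZ; [exact: av|apply: Cv; rewrite mem_head].
  move: aw_le0; rewrite le_eqVlt => /predU1P[->|aw0].
    by rewrite scale0r subr0.
  apply: CD => //; rewrite -scaleNr; apply: CZ; first by rewrite oppr_gt0.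
  by apply: Cv; rewrite inE ir orbT.
pose a1 p := dotrow (b p) (w p) *: a p - dotrow (a p) (w p) *: b p.
have ea1 : expsum_row a1.
  by apply: expsum_rowB; apply: expsum_rowZ => //; exact: expsum_dotrow.
have a1w p : dotrow (a1 p) (w p) = 0.
  by rewrite /a1 dotrowBl !dotrowZl mulrC subrr.
have a1v i p : dotrow (a1 p) (v i p) = dotrow (b p) (u i p).
  by rewrite /a1 /u dotrowBl dotrowBr !dotrowZl !dotrowZr mulrC.
have [||M [L [eM eL L0 ML]]] := @expsum_scale_dominate R I r
    (fun i p => dotrow (a1 p) (v i p)) (fun i p => dotrow (w p) (v i p)).
- move=> i ir; split; first by apply: expsum_dotrow => //; exact: ev.
  by apply: filterS (b_gt0 i ir) => p; rewrite a1v.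
- by move=> i /ev; exact: expsum_dotrow.
left; exists (fun p => M p *: a1 p + L p *: w p); split.
  by apply: expsum_rowD; exact: expsum_rowZ.
move=> i; rewrite inE => /predU1P[->|ir].
  near=> p; rewrite dotrowDl !dotrowZl a1w mulr0 add0r.
  by apply: mulr_gt0; near: p.
apply: filterS (ML i ir) => p MLp.
by rewrite dotrowDl [X in X + _]dotrowZl [X in _ + X]dotrowZl.
Unshelve. all: by end_near. Qed.

(** * The maps phi and their inverses *)

Lemma ler_phi (R : realType) p : {mono @phi R p : x y / x <= y}.
Proof.
apply: le_mono => x y xy.
have [y0|y0] := leP y 0.
  have ny0 : 0 <= - y by rewrite oppr_ge0.
  rewrite -ltrN2 -!phiN /phi ltr_pXn2r ?nnegrE ?ltrN2// ltW//.
  by rewrite (le_lt_trans ny0)// ltrN2.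
have [x0|x0] := leP 0 x; first by rewrite /phi ltr_pXn2r ?nnegrE// ltW.
rewrite (@lt_trans _ _ 0)//; last by rewrite /phi exprn_gt0.
by rewrite -oppr_gt0 -phiN /phi exprn_gt0// oppr_gt0.
Qed.

Lemma phi1 (R : realType) p : phi p (1 : R) = 1.
Proof. by rewrite /phi expr1n. Qed.

Lemma phi_sign (R : realType) p (b : bool) :
  phi p ((-1) ^+ b : R) = (-1) ^+ b.
Proof. by case: b; rewrite ?expr1 ?expr0 ?phiN phi1. Qed.

Lemma phi_inv_le (R : realType) p (t c : R) : (phi_inv p t <= c) = (t <= phi p c).
Proof. by rewrite -[in RHS](phi_invK p t) ler_phi. Qed.

Lemma phi_inv_ge (R : realType) p (t c : R) : (c <= phi_inv p t) = (phi p c <= t).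
Proof. by rewrite -[in RHS](phi_invK p t) ler_phi. Qed.

Lemma phi_inv_lt (R : realType) p (t c : R) : (c < phi_inv p t) = (phi p c < t).
Proof. by rewrite !ltNge phi_inv_le. Qed.

(** A fixed number of terms of modulus [r] cannot compensate one of modulus
    [s > r] once the exponent is large: the max-like behaviour of the limit
    inner product comes from here. *)
Lemma natmul_phi_le (R : realType) (n : nat) (r s : R) : 0 <= r -> r < s ->
  \forall p \near \oo, n%:R * phi p r <= phi p s.
Proof.
move=> r0 rs; have s0 : 0 < s by exact: le_lt_trans rs.
pose g := r / s; have g0 : 0 <= g by rewrite divr_ge0// ltW.
have g1 : g < 1 by rewrite ltr_pdivrMr// mul1r.
have : (fun p => n%:R * g ^+ p) @ \oo --> n%:R * (0 : R).
  by apply: cvgM; [exact: cvg_cst|apply: cvg_expr; rewrite ger0_norm].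
rewrite mulr0 => ng; apply: filterS (cvgr_le _ ng 1 ltr01) => p np.
have rE : r = g * s by rewrite /g divfK// gt_eqF.
rewrite rE /phi exprMn mulrA ler_piMl ?exprn_ge0 ?(ltW s0)//.
apply: le_trans np; rewrite ler_wpM2l//.
by rewrite ler_wiXn2l ?(ltW g1)// -addn1 mul2n -addnn -addnA leq_addr.
Qed.

(** * Convex hulls and their preimages *)

Lemma conv_hull_sub (R : realType) n (S : set 'rV[R]_n) : S `<=` conv_hull S.
Proof. exact: sub_gen_smallest. Qed.

Lemma conv_hull_convex (R : realType) n (S : set 'rV[R]_n) x y (t : R) :
  0 <= t <= 1 -> conv_hull S x -> conv_hull S y ->
  conv_hull S (t *: x + (1 - t) *: y).
Proof.
move=> t01 Sx Sy T [cT ST].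
have xT : x \in T by rewrite inE; exact: Sx.
have yT : y \in T by rewrite inE; exact: Sy.
have := cT x y (Itv01 (proj1 (andP t01)) (proj2 (andP t01))) xT yT.
by rewrite inE.
Qed.

Lemma conv_hull_halfspace (R : realType) n (S : set 'rV[R]_n) a (c : R) :
  (forall x, S x -> dotrow a x <= c) ->
  forall x, conv_hull S x -> dotrow a x <= c.
Proof.
move=> Sc; apply: smallest_sub => // x y t; rewrite !inE /= => xc yc.
rewrite (_ : conv t x y = t%:num *: (x : 'rV[R]_n) + (1 - t%:num) *: (y : 'rV_n))//.
have t0 : 0 <= t%:num by [].
have t1 : t%:num <= 1 by [].
rewrite dotrowDr !dotrowZr.
have := ler_wpM2l t0 xc; have := @ler_wpM2l _ (1 - t%:num) _ _ _ yc.
by rewrite subr_ge0 => /(_ t1); lra.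
Qed.

Lemma Cop_halfspace (R : realType) n p (A : set 'rV[R]_n) a (c : R) :
  (forall x, A x -> dotrow a (phin p x) <= c) ->
  forall x, Cop p A x -> dotrow a (phin p x) <= c.
Proof.
move=> Ac x; apply: conv_hull_halfspace => _ [y Ay <-]; exact: Ac.
Qed.

Lemma Cop0 (R : realType) n p : Cop p (@set0 'rV[R]_n) = set0.
Proof.
by rewrite /Cop /conv_hull image_set0 smallest_id ?preimage_set0//.
Qed.

Lemma dotrow_delta (R : realType) n (i : 'I_n) (x : 'rV[R]_n) :
  dotrow (delta_mx 0 i) x = x 0 i.
Proof.
rewrite /dotrow (bigD1 i)//= mxE !eqxx mul1r big1 ?addr0// => j ji.
by rewrite mxE eqxx (negbTE ji) mul0r.
Qed.

Lemma Cop_bounded (R : realType) n (A : set 'rV[R]_n) (B : R) :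
  (forall x, A x -> forall i, `|x 0 i| <= B) ->
  forall p x, Cop p A x -> forall i, `|x 0 i| <= B.
Proof.
move=> AB p x Ax i; rewrite ler_norml lerNl -(ler_phi p) -(ler_phi p (x 0 i)).
apply/andP; split.
  have := @Cop_halfspace R n p A (- delta_mx 0 i) (phi p B) _ x Ax.
  rewrite -scaleN1r dotrowZl dotrow_delta mulN1r mxE phiN; apply => y Ay.
  rewrite dotrowZl dotrow_delta mulN1r mxE -phiN ler_phi lerNl.
  by have := AB y Ay i; rewrite ler_norml => /andP[].
have := @Cop_halfspace R n p A (delta_mx 0 i) (phi p B) _ x Ax.
rewrite dotrow_delta mxE; apply => y Ay.
rewrite dotrow_delta mxE ler_phi.
by have := AB y Ay i; rewrite ler_norml => /andP[].
Qed.

(** * Accumulation of common points *)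

Lemma finite_set_row_bounded (R : realType) n (A : set 'rV[R]_n) :
  finite_set A -> exists2 B : R, 0 <= B &
    forall x, A x -> forall i, `|x 0 i| <= B.
Proof.
move=> /finite_seqP[s ->]; exists (\sum_(x <- s) \sum_i `|x 0 i|).
  by apply: sumr_ge0 => x _; apply: sumr_ge0.
move=> x /= xs i; rewrite (perm_big _ (perm_to_rem xs)) big_cons /= (bigD1 i)//=.
rewrite -addrA lerDl addr_ge0 ?sumr_ge0// => y _; exact: sumr_ge0.
Qed.

Lemma cvg_row (R : realType) n (u : nat -> 'rV[R]_n) (x : 'rV[R]_n) :
  (forall i, (fun m => u m 0 i) @ \oo --> x 0 i) -> u @ \oo --> x.
Proof.
move=> ux; apply/cvgrPdist_lt => e e0.
near=> m; rewrite [ltLHS]/Num.Def.normr/= mx_normrE; apply/bigmax_ltP; split => //.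
move=> [i j] _ /=; rewrite !mxE ord1; move: j {i}; near: m; apply: filter_forall.
by move=> i; have /cvgrPdist_lt := ux i; apply.
Unshelve. all: by end_near. Qed.

Lemma cvg_increasing (k : nat -> nat) : increasing_seq k -> k @ \oo --> \oo.
Proof.
move=> ik; have km m : (m <= k m)%N.
  elim: m => // m; rewrite -ltnS => /leq_trans; apply.
  by have /increasing_seqP := ik; apply.
by apply/cvgnyPge => N; exists N => // m /= /leq_trans; apply.
Qed.

Lemma bounded_row_cvg_subseq (R : realType) n (u : nat -> 'rV[R]_n) (B : R) :
  (forall m i, `|u m 0 i| <= B) ->
  exists2 f : nat -> nat, increasing_seq f &
    exists x : 'rV[R]_n, u \o f @ \oo --> x.
Proof.
move=> uB.
have [f fi fx] : exists2 f : nat -> nat, increasing_seq f &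
    forall i, i \in enum 'I_n -> cvgn (fun m => u (f m) 0 i).
  elim: (enum 'I_n) => [|i r [f fi fr]]; first by exists id.
  have [|g gi gx] := @bolzano_weierstrass R (fun m => u (f m) 0 i).
    exists B; split=> [|M BM m _ /=]; first exact: num_real.
    by rewrite (le_trans (uB _ _))// ltW.
  exists (f \o g) => [m m'|j]; first by rewrite /= fi -leEnat gi.
  rewrite inE => /predU1P[->//|/fr jr].
  apply/cvg_ex; exists (limn (fun m => u (f m) 0 j)).
  exact: cvg_comp (cvg_increasing gi) jr.
exists f => //; exists (\row_i limn (fun m => u (f m) 0 i)).
by apply: cvg_row => i; rewrite mxE; apply: fx; rewrite mem_enum.
Qed.

(** The points have to be common to both sets before a subsequence is extracted,
    so that one sequence of exponents witnesses both memberships. *)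
Lemma Coinfty_meet (R : realType) n (A E : set 'rV[R]_n) : finite_set A ->
  (\forall p \near \oo, Cop p A `&` Cop p E !=set0) ->
  Coinfty A `&` Coinfty E !=set0.
Proof.
move=> /finite_set_row_bounded[B _ AB] [N _ AE].
have /choice[u uP] : forall m, exists x, (Cop (N + m) A `&` Cop (N + m) E) x.
  by move=> m; apply: AE => /=; exact: leq_addr.
have [|f fi [x ux]] := @bounded_row_cvg_subseq R n u B.
  by move=> m; apply: Cop_bounded AB _ _ (uP m).1.
exists x; split; exists (fun m => N + f m)%N, (u \o f); split => // m.
- by move=> m'; rewrite !leEnat leq_add2l -!leEnat fi.
- exact: (uP _).1.
- by move=> m'; rewrite !leEnat leq_add2l -!leEnat fi.
- exact: (uP _).2.
Qed.


(** * The limit inner products *)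

Lemma smile_big_absorb (R : realType) n (z : 'I_n -> R) i :
  smile (z i) (\big[smile/0]_j z j) = \big[smile/0]_j z j.
Proof.
by rewrite (bigD1 i)//= smileA; congr smile; rewrite /smile ltxx eqxx minxx.
Qed.

(** A tie in modulus is resolved downwards, so when the fold is positive no
    factor can be its opposite ([smile_big_gtN]). *)
Lemma smile_big_dom (R : realType) n (z : 'I_n -> R) i
  (m := \big[smile/0]_j z j) : `|z i| <= `|m| /\ (`|z i| = `|m| -> m <= z i).
Proof.
have := smile_big_absorb z i; rewrite -/m /smile.
case: (ltgtP `|m| `|z i|) => [mz zm|zm _|mz minE].
- by move: mz; rewrite zm ltxx.
- by split=> // /eqP; rewrite lt_eqF.
- by split=> [|_]; rewrite ?mz// -minE ge_min lexx.
Qed.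

Lemma smile_big_attained (R : realType) n (z : 'I_n -> R) :
  \big[smile/0]_j z j = 0 \/ exists i, \big[smile/0]_j z j = z i.
Proof.
elim/big_ind : _ => [|u v u_z v_z|i _]; [by left| |by right; exists i].
rewrite /smile /Num.min; by repeat case: ifP.
Qed.

Lemma smile_big_ge (R : realType) n (z : 'I_n -> R) i :
  \big[smile/0]_j z j <= 0 -> \big[smile/0]_j z j <= z i.
Proof.
by move=> m0; have [+ _] := smile_big_dom z i; rewrite (ler0_norm m0) ler_norml opprK => /andP[].
Qed.

Lemma smile_big_gtN (R : realType) n (z : 'I_n -> R) i :
  0 < \big[smile/0]_j z j -> - (\big[smile/0]_j z j) < z i.
Proof.
move=> m0; have [zm zmE] := smile_big_dom z i.
rewrite ltNge; apply/negP => zi.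
have zi0 : z i < 0 by rewrite (le_lt_trans zi)// oppr_lt0.
move: zm zmE; rewrite (ltr0_norm zi0) (gtr0_norm m0) => zm.
have -> : - z i = \big[smile/0]_j z j by apply/eqP; rewrite eq_le zm lerNr zi.
by move=> /(_ erefl); rewrite leNgt (lt_trans zi0 m0).
Qed.

(** When the products of largest modulus have both signs, the inner products for
    finite exponents may accumulate anywhere between the two extreme values;
    [inner_minus] is then the lower one. Two cases: if it is nonpositive, every
    product is eventually at least [e > d], and [n] times [phi e] is at least
    [phi d]; if it is positive, it is one of the products, which dominates the
    sum since all the others stay strictly above its opposite. *)
Lemma inner_minus_lt_lim (R : realType) n (k : nat -> nat)
  (a u : nat -> 'rV[R]_n) (b x : 'rV[R]_n) (d : R) :
  k @ \oo --> \oo -> a @ \oo --> b -> u @ \oo --> x -> d < inner_minus b x ->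
  \forall m \near \oo, d <= inner_p (k m) (a m) (u m).
Proof.
move=> koo ab ux; rewrite /inner_minus => dm.
pose z i := b 0 i * x 0 i; pose zm i m := a m 0 i * u m 0 i.
have zmz i : zm i @ \oo --> z i.
  apply: cvgM.
    exact: cvg_comp ab (@coord_continuous R 1 n 0 i b).
  exact: cvg_comp ux (@coord_continuous R 1 n 0 i x).
suff : \forall m \near \oo, phi (k m) d <= \sum_i phi (k m) (zm i m).
  apply: filterS => m; rewrite inner_pE phi_inv_ge; exact.
have growth r s : 0 <= r -> r < s ->
    \forall m \near \oo, n%:R * phi (k m) r <= phi (k m) s.
  by move=> r0 rs; exact: (koo _ (natmul_phi_le n r0 rs)).
rewrite -/(z _) in dm; set mu := \big[smile/0]_i _ in dm.
have [mu0|mu_gt0] := leP mu 0.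
  pose e := (d + mu) / 2.
  have de : d < e by rewrite /e; lra.
  have em : e < mu by rewrite /e; lra.
  near=> m.
  have ze : forall i, e <= zm i m.
    near: m; apply: filter_forall => i; apply: (cvgr_ge _ (zmz i)).
    by rewrite (lt_le_trans em)// smile_big_ge.
  have ne : n%:R * phi (k m) (- e) <= phi (k m) (- d).
    by near: m; apply: growth; lra.
  apply: (@le_trans _ _ (\sum_(i < n) phi (k m) e)).
    move: ne; rewrite !phiN mulrN lerN2 sumr_const card_ord.
    by rewrite mulr_natl.
  by apply: ler_sum => i _; rewrite ler_phi.
have [//|[i0 mi0]] := smile_big_attained z; first by move: mu_gt0; rewrite /mu => + E; rewrite E ltxx.
(* D bounds d, 0 and all the opposites of the products, and is still less than
   mu; d1 < e are points strictly between them. *)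
pose D := \big[Num.max/Num.max d 0]_i (- z i).
have Dmu : D < mu.
  apply/bigmax_ltP; split; first by rewrite gt_max dm.
  by move=> i _; rewrite ltrNl smile_big_gtN.
have D0 : 0 <= D by apply: le_trans (bigmax_ge_id _ _ _ _); rewrite le_max lexx orbT.
have Dd : d <= D by apply: le_trans (bigmax_ge_id _ _ _ _); rewrite le_max lexx.
have Dz i : - D <= z i by rewrite lerNl; apply: (le_bigmax _ (fun i => - z i) i).
pose d1 := (2 * D + mu) / 3; pose e := (D + 2 * mu) / 3.
have d1D : D < d1 by rewrite /d1; lra.
have d1e : d1 < e by rewrite /d1 /e; lra.
have em : e < mu by rewrite /e; lra.
near=> m.
have zd : forall i, - d1 <= zm i m.
  near: m; apply: filter_forall => i; apply: (cvgr_ge _ (zmz i)).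
  by rewrite (lt_le_trans _ (Dz i))// ltrN2.
have ze : e <= zm i0 m.
  by near: m; apply: (cvgr_ge _ (zmz i0)); rewrite -mi0.
have ne : n%:R * phi (k m) d1 <= phi (k m) e.
  by near: m; apply: growth => //; lra.
have : phi (k m) (zm i0 m) + phi (k m) d1 <= \sum_i (phi (k m) (zm i m) + phi (k m) d1).
  rewrite (bigD1 i0)//= lerDl sumr_ge0// => i _.
  by rewrite -lerBlDr sub0r -phiN ler_phi.
rewrite big_split /= sumr_const card_ord -mulr_natl.
have : phi (k m) e <= phi (k m) (zm i0 m) by rewrite ler_phi.
have : phi (k m) d <= phi (k m) d1 by rewrite ler_phi; lra.
lra.
Unshelve. all: by end_near. Qed.

Lemma inner_pN (R : realType) n p (a x : 'rV[R]_n) :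
  inner_p p a (- x) = - inner_p p a x.
Proof.
rewrite -phi_invN; congr phi_inv; rewrite -sumrN; apply: eq_bigr => i _.
by rewrite !mxE phiN mulrN.
Qed.

Lemma inner_p_dotrow (R : realType) n p (a x : 'rV[R]_n) :
  inner_p p a x = phi_inv p (dotrow (phin p a) (phin p x)).
Proof. by []. Qed.

Lemma inner_p_bound (R : realType) n p (a x : 'rV[R]_n) (B : R) :
  0 <= B -> (0 < n)%N -> (forall i, `|a 0 i| <= 1) -> (forall i, `|x 0 i| <= B) ->
  `|inner_p p a x| <= n%:R * B.
Proof.
move=> B0 n0 a1 xB.
have ub (y : 'rV[R]_n) : (forall i, `|y 0 i| <= B) -> inner_p p a y <= n%:R * B.
  move=> yB; rewrite inner_pE phi_inv_le.
  apply: (@le_trans _ _ (\sum_(i < n) phi p B)).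
    apply: ler_sum => i _; rewrite -[_ ^+ _]/(phi p _) ler_phi.
    rewrite (le_trans (ler_norm _))// normrM -[leRHS]mul1r.
    by rewrite ler_pM.
  rewrite sumr_const card_ord -[leLHS]mulr_natl /phi exprMn ler_wpM2r ?exprn_ge0//.
  by rewrite ler_eXnr// ler1n.
rewrite ler_norml ub// andbT lerNl -inner_pN ub// => i.
by rewrite mxE normrN.
Qed.

(** The convergence of [a] and [c] along all exponents makes the bound hold for
    every subsequence that defines a point of the upper limit. *)
Lemma Ls_inner_minus_le (R : realType) n (S : nat -> set 'rV[R]_n)
  (a : nat -> 'rV[R]_n) (c : nat -> R) (b : 'rV[R]_n) (l : R) :
  a @ \oo --> b -> c @ \oo --> l ->
  (\forall p \near \oo, forall x, S p x -> inner_p p (a p) x <= c p) ->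
  forall x, Ls S x -> inner_minus b x <= l.
Proof.
move=> ab cl ac x [k [u [ik ku ux]]]; have koo := cvg_increasing ik.
rewrite leNgt; apply/negP => lx.
pose d := (l + inner_minus b x) / 2.
have dx : d < inner_minus b x by rewrite /d; lra.
have ld : l < d by rewrite /d; lra.
have H1 := inner_minus_lt_lim koo (cvg_comp _ _ koo ab) ux dx.
have H2 : \forall m \near \oo, c (k m) < d by exact: (koo _ (cvgr_lt _ cl _ ld)).
have H3 := koo _ ac.
near \oo => m.
have : d < d; last by rewrite ltxx.
have h1 : d <= inner_p (k m) (a (k m)) (u m) by near: m.
have h2 : c (k m) < d by near: m.
have h3 : forall x, S (k m) x -> inner_p (k m) (a (k m)) x <= c (k m) by near: m.
exact: le_lt_trans (le_trans h1 (h3 _ (ku m))) h2.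
Unshelve. all: by end_near. Qed.

Lemma LsN (R : realType) n (S : nat -> set 'rV[R]_n) (x : 'rV[R]_n) :
  Ls S x -> Ls (fun p => -%R @^-1` S p) (- x).
Proof.
move=> [k [u [ik ku ux]]]; exists k, (fun m => - u m); split => //.
  by move=> m; rewrite /= opprK.
exact: cvgN.
Qed.

Lemma Ls_inner_plus_ge (R : realType) n (S : nat -> set 'rV[R]_n)
  (a : nat -> 'rV[R]_n) (c : nat -> R) (b : 'rV[R]_n) (l : R) :
  a @ \oo --> b -> c @ \oo --> l ->
  (\forall p \near \oo, forall x, S p x -> c p <= inner_p p (a p) x) ->
  forall x, Ls S x -> l <= inner_plus b x.
Proof.
move=> ab cl ac x /LsN Sx; rewrite /inner_plus lerNr.
apply: (Ls_inner_minus_le ab (cvgN cl) _ Sx).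
by apply: filterS ac => p ac y /ac; rewrite inner_pN lerNr.
Qed.


(** * Alternative and convergence for exponents going to infinity *)

(** Gordan's alternative for the differences [phi_p(e) - phi_p(x)], tested on the
    cone generated by the differences of points of the two hulls: this cone
    contains 0 exactly when the hulls meet. *)
Lemma meet_or_expsum_separation (R : realType) (n : nat)
  (s t : seq 'rV[R]_n) :
  (\forall p \near \oo, Cop p [set` s] `&` Cop p [set` t] !=set0) \/
  (exists a, expsum_row a /\ forall x e, x \in s -> e \in t ->
    \forall p \near \oo, dotrow (a p) (phin p x) < dotrow (a p) (phin p e)).
Proof.
pose r := [seq (x, e) | x <- s, e <- t].
pose v (z : 'rV[R]_n * 'rV[R]_n) p := phin p z.2 - phin p z.1.
have ephin (x : 'rV[R]_n) : expsum_row (fun p => phin p x).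
  move=> i; have := expsum_phi (x 0 i); congr expsum.
  by apply/funext => p; rewrite mxE.
have [|[a [ea a_gt0]]|meet] := @gordan_expsum R n _ r v.
- by move=> z _; exact: expsum_rowB.
- right; exists a; split=> // x e xs et.
  have /a_gt0 : (x, e) \in r by exact: allpairs_f.
  by apply: filterS => p; rewrite /v dotrowBr subr_gt0.
left; apply: filterS meet => p meet.
set H := conv_hull (phin p @` [set` s]); set K := conv_hull (phin p @` [set` t]).
pose C : set 'rV[R]_n := [set z | exists (l : R) x y,
  [/\ 0 < l, H x, K y & z = l *: (y - x)]].
have coneC : cone C.
  split=> [z1 z2 [l [x [y [l0 Hx Ky ->]]]] [m [x' [y' [m0 Hx' Ky' ->]]]]|c z c0].
    have lm0 : 0 < l + m by exact: addr_gt0.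
    (* The sum of l (y - x) and m (y' - x') is l + m times the difference of the
       averages with weights l / (l + m) and m / (l + m). *)
    pose c := l / (l + m).
    have c1 : 1 - c = m / (l + m) by rewrite /c; field; exact: lt0r_neq0.
    have c01 : 0 <= c <= 1.
      by rewrite divr_ge0 ?(ltW l0) ?(ltW lm0)//= -subr_ge0 c1 divr_ge0 ?ltW.
    exists (l + m), (c *: x + (1 - c) *: x'), (c *: y + (1 - c) *: y').
    split => //; try exact: conv_hull_convex.
    apply/rowP => i; rewrite c1 !mxE /c; field; exact: lt0r_neq0.
  move=> [l [x [y [l0 Hx Ky ->]]]]; exists (c * l), x, y.
  by rewrite scalerA mulr_gt0.
have [_ /allpairsP[[x e] /= [xs et ->]]|l [x [y [l0 Hx Ky]]]] := meet C coneC.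
  exists 1, (phin p x), (phin p e); rewrite scale1r; split => //.
    by apply: conv_hull_sub; exists x.
  by apply: conv_hull_sub; exists e.
move=> /esym/eqP; rewrite scaler_eq0 gt_eqF//= subr_eq0 => /eqP yx.
have pE : phin p (map_mx (phi_inv p) x) = x.
  by apply/rowP => i; rewrite !mxE phi_invK.
by exists (map_mx (phi_inv p) x); split; rewrite /Cop /= pE // -yx.
Qed.

Lemma expsum_max (R : realType) (I : eqType) (r : seq I) (f : I -> nat -> R) :
  (forall i, expsum (f i)) -> r != [::] ->
  exists2 i, i \in r & forall j, j \in r -> \forall p \near \oo, f j p <= f i p.
Proof.
move=> ef; apply: total_preorder_max => [i j|j i k ij jk].
  have [ij|ij] := expsum_gt0_or_le0 (expsumB (ef i) (ef j)); [right|left].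
    by apply: filterS ij => p; rewrite subr_gt0 => /ltW.
  by apply: filterS ij => p; rewrite subr_le0.
by apply: filterS2 ij jk => p; exact: le_trans.
Qed.

(** The limit is the supremum of the constants that are eventually below [h]. *)
Lemma comparable_bounded_cvg (R : realType) (h : nat -> R) (B : R) :
  (forall M, (\forall p \near \oo, h p <= M) \/
             (\forall p \near \oo, M < h p)) ->
  (\forall p \near \oo, `|h p| <= B) -> cvgn h.
Proof.
move=> h_comp hB; pose S := [set M | \forall p \near \oo, M < h p].
have Sub M : (\forall p \near \oo, h p <= M) -> ubound S M.
  move=> hM x Sx; near \oo => p; apply: (@le_trans _ _ (h p)).
    by apply: ltW; near: p.
  by near: p.
have supS : has_sup S.
  split; last first.
    exists B; apply: Sub; apply: filterS hB => p.
    by rewrite ler_norml => /andP[].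
  exists (- B - 1); apply: filterS hB => p; rewrite ler_norml => /andP[+ _].
  by apply: lt_le_trans; rewrite ltrBlDr ltrDl.
apply/cvg_ex; exists (sup S); apply/cvgrPdist_le => e e0.
have [M SM Mlt] := sup_adherent e0 supS.
have hS : \forall p \near \oo, h p <= sup S + e.
  have [//|Se] := h_comp (sup S + e).
  have := ub_le_sup supS.2 Se; lra.
near=> p; rewrite ler_distlC; apply/andP; split; last by near: p.
apply/ltW/(lt_trans Mlt); near: p; exact: SM.
Unshelve. all: by end_near. Qed.

(** Being at most [M] is the sign condition [f - phi_p(M) * d <= 0] on an exponential
    sum, hence eventually true or eventually false. *)
Lemma cvg_phi_inv_ratio (R : realType) (f d : nat -> R) (B : R) :
  expsum f -> expsum d -> (\forall p \near \oo, 0 < d p) ->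
  (\forall p \near \oo, `|phi_inv p (f p / d p)| <= B) ->
  cvgn (fun p => phi_inv p (f p / d p)).
Proof.
move=> ef ed d0; apply: comparable_bounded_cvg => M.
have [fM|fM] := expsum_gt0_or_le0 (expsumB ef (expsumM (expsum_phi M) ed)).
  right; apply: filterS2 d0 fM => p d0; rewrite subr_gt0 phi_inv_lt.
  by rewrite ltr_pdivlMr.
left; apply: filterS2 d0 fM => p d0; rewrite subr_le0 phi_inv_le.
by rewrite ler_pdivrMr.
Qed.

(** The index ranges over signed coordinates, so that the largest modulus [d] is
    itself an exponential sum. *)
Lemma expsum_row_leading_entry (R : realType) (n : nat)
  (a : nat -> 'rV[R]_n) : (0 < n)%N -> expsum_row a ->
  (\forall p \near \oo, a p != 0) ->
  exists (d : nat -> R) (b : bool) (i0 : 'I_n),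
    [/\ expsum d, \forall p \near \oo, 0 < d p,
        \forall p \near \oo, forall i, `|a p 0 i| <= d p &
        forall p, a p 0 i0 = (-1) ^+ b * d p].
Proof.
move=> n_gt0 ea a0; pose f (z : bool * 'I_n) p := (-1) ^+ z.1 * a p 0 z.2.
have ef z : expsum (f z) by apply: expsumM => //; exact: expsum_cst.
have [[b i0] _ d_max] : exists2 z, z \in enum {: bool * 'I_n} &
    forall z', z' \in enum {: bool * 'I_n} ->
      \forall p \near \oo, f z' p <= f z p.
  apply: expsum_max => //; rewrite -size_eq0 -lt0n -cardE.
  by rewrite card_prod card_bool card_ord muln_gt0.
pose d := f (b, i0).
have a_le : \forall p \near \oo, forall i, `|a p 0 i| <= d p.
  apply: filter_forall => i.
  have fle b' : \forall p \near \oo, f (b', i) p <= d p.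
    by apply: d_max; rewrite mem_enum.
  apply: filterS2 (fle false) (fle true) => p.
  by rewrite /f /= expr0 mul1r expr1 mulN1r ler_norml lerNl => -> ->.
exists d, b, i0; split => //; first exact: ef; last first.
  by move=> p; rewrite /d /f /= signrMK.
have [//|d_le0] := expsum_gt0_or_le0 (ef (b, i0)).
apply: filterS2 a0 (filterI d_le0 a_le) => p /eqP + [dp ap]; case.
apply/rowP => i; rewrite mxE; apply/eqP; rewrite -normr_le0.
exact: le_trans (ap i) dp.
Qed.

(** * Separation *)

Lemma Cop_seq_le (R : realType) (n p : nat) (s : seq 'rV[R]_n) a (c : R) :
  (forall x, x \in s -> dotrow a (phin p x) <= c) ->
  forall x, Cop p [set` s] x -> dotrow a (phin p x) <= c.
Proof. by move=> sc; apply: Cop_halfspace => x /=; exact: sc. Qed.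

Lemma Cop_seq_ge (R : realType) (n p : nat) (s : seq 'rV[R]_n) a (c : R) :
  (forall x, x \in s -> c <= dotrow a (phin p x)) ->
  forall x, Cop p [set` s] x -> c <= dotrow a (phin p x).
Proof.
move=> sc x sx; rewrite -lerN2 -mulN1r -dotrowZl; apply: Cop_seq_le sx => y ys.
by rewrite dotrowZl mulN1r lerN2 sc.
Qed.

(** The three claims of the theorem follow from this property alone: the first
    two are read off it, and convergence gives the third. *)
Definition convergent_separation (R : realType) (n : nat)
    (A E : set 'rV[R]_n) : Prop :=
  exists (a : nat -> 'rV[R]_n) (c : nat -> R) (b : 'rV[R]_n) (l : R),
    [/\ a @ \oo --> b, c @ \oo --> l, b != 0 &
      \forall p \near \oo, [/\ a p != 0, Cop p A `&` Cop p E = set0,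
        forall x, Cop p A x -> inner_p p (a p) x <= c p &
        forall x, Cop p E x -> c p <= inner_p p (a p) x]].

Lemma inner_p_const_bounded (R : realType) (n : nat) (E : set 'rV[R]_n) :
  (0 < n)%N -> finite_set E ->
  exists c : R, forall p x, Cop p E x -> `|inner_p p (const_mx 1) x| <= c.
Proof.
move=> n_gt0 /finite_set_row_bounded[B B0 EB]; exists (n%:R * B) => p x Ex.
apply: inner_p_bound => //; last exact: Cop_bounded EB _ _ Ex.
by move=> i; rewrite mxE normr1.
Qed.

Lemma const_mx1_neq0 (R : realType) (n : nat) : (0 < n)%N ->
  const_mx 1 != 0 :> 'rV[R]_n.
Proof.
move=> n0; apply/eqP => /rowP /(_ (Ordinal n0)); rewrite !mxE => /eqP.
by rewrite oner_eq0.
Qed.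

Lemma convergent_separation_set0l (R : realType) (n : nat)
  (E : set 'rV[R]_n) : (0 < n)%N -> finite_set E ->
  convergent_separation set0 E.
Proof.
move=> n_gt0 finE; have [c Ec] := inner_p_const_bounded n_gt0 finE.
exists (fun=> const_mx 1), (fun=> - c), (const_mx 1), (- c).
split; [exact: cvg_cst|exact: cvg_cst|exact: const_mx1_neq0|].
apply: nearW => p; rewrite Cop0; split => //; first exact: const_mx1_neq0.
  by rewrite set0I.
by move=> x /Ec; rewrite ler_norml => /andP[].
Qed.

Lemma convergent_separation_set0r (R : realType) (n : nat)
  (A : set 'rV[R]_n) : (0 < n)%N -> finite_set A ->
  convergent_separation A set0.
Proof.
move=> n_gt0 finA; have [c Ac] := inner_p_const_bounded n_gt0 finA.
exists (fun=> const_mx 1), (fun=> c), (const_mx 1), c.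
split; [exact: cvg_cst|exact: cvg_cst|exact: const_mx1_neq0|].
apply: nearW => p; rewrite Cop0; split => //; first exact: const_mx1_neq0.
  by rewrite setI0.
by move=> x /Ac; rewrite ler_norml => /andP[].
Qed.

(** The threshold is the inner product with a point [x0] of the first set that
    maximizes [<a, phi_p(x)>] for all large [p], so that it is again given by a
    ratio of exponential sums. A minimizing point [e0] of the second set turns
    the strict inequalities between the finitely many vertices into strict
    separation of the hulls. *)
Lemma convergent_separation_of_expsum (R : realType) (n : nat)
  (s t : seq 'rV[R]_n) (a : nat -> 'rV[R]_n) :
  (0 < n)%N -> s != [::] -> t != [::] -> expsum_row a ->
  (forall x e, x \in s -> e \in t ->
    \forall p \near \oo, dotrow (a p) (phin p x) < dotrow (a p) (phin p e)) ->
  convergent_separation [set` s] [set` t].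
Proof.
move=> n_gt0 s_neq0 t_neq0 ea a_sep.
have edot (x : 'rV[R]_n) : expsum (fun p => dotrow (a p) (phin p x)).
  apply: expsum_dotrow => // i; have := expsum_phi (x 0 i); congr expsum.
  by apply/funext => p; rewrite mxE.
have [x0 x0s x0_max] : exists2 x0, x0 \in s & forall x, x \in s ->
    \forall p \near \oo, dotrow (a p) (phin p x) <= dotrow (a p) (phin p x0).
  exact: expsum_max.
have [e0 e0t e0_min] : exists2 e0, e0 \in t & forall e, e \in t ->
    \forall p \near \oo,
      - dotrow (a p) (phin p e) <= - dotrow (a p) (phin p e0).
  apply: (@expsum_max _ _ t (fun e p => - dotrow (a p) (phin p e))) => //.
  by move=> e; exact: expsumN.
have a0 : \forall p \near \oo, a p != 0.
  apply: filterS (a_sep _ _ x0s e0t) => p; apply: contraTneq => ->.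
  by rewrite -[0]subr0 !dotrowBl !subrr ltxx.
have [d [b0 [i0 [ed d_gt0 a_le a_i0]]]] := expsum_row_leading_entry n_gt0 ea a0.
pose al p : 'rV[R]_n := \row_i phi_inv p (a p 0 i / d p).
have phin_al p : phin p (al p) = (d p)^-1 *: a p.
  by apply/rowP => i; rewrite !mxE phi_invK mulrC.
have al_le1 : \forall p \near \oo, forall i, `|al p 0 i| <= 1.
  apply: filterS2 d_gt0 a_le => p dp ap i; rewrite mxE.
  have := ap i; rewrite !ler_norml => /andP[a1 a2].
  rewrite phi_inv_le phi_inv_ge phiN phi1 ler_pdivrMr// ler_pdivlMr//.
  by rewrite mulN1r mul1r a1.
have al_i0 : \forall p \near \oo, al p 0 i0 = (-1) ^+ b0.
  apply: filterS d_gt0 => p dp.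
  by rewrite mxE a_i0 mulfK ?gt_eqF// -[in LHS](@phi_sign R p) phiK.
pose bl : 'rV[R]_n := \row_i limn (fun p => al p 0 i).
have al_cvg i : (fun p => al p 0 i) @ \oo --> bl 0 i.
  have alE p : al p 0 i = phi_inv p (a p 0 i / d p) by rewrite mxE.
  rewrite mxE (funext alE); apply: (@cvg_phi_inv_ratio _ _ _ 1) => //.
  by apply: filterS al_le1 => p /(_ i); rewrite alE.
pose c p := inner_p p (al p) x0.
have innerE p x :
    inner_p p (al p) x = phi_inv p ((d p)^-1 * dotrow (a p) (phin p x)).
  by rewrite inner_p_dotrow phin_al dotrowZl.
have [B B0 sB] := finite_set_row_bounded (finite_seq s).
have c_cvg : c @ \oo --> limn c.
  have cE p : c p = phi_inv p (dotrow (a p) (phin p x0) / d p).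
    by rewrite /c innerE mulrC.
  rewrite (funext cE); apply: (@cvg_phi_inv_ratio _ _ _ (n%:R * B)) => //.
  apply: filterS al_le1 => p alp; rewrite -cE.
  by apply: inner_p_bound => // i; exact: sB.
exists al, c, bl, (limn c); split => //; first exact: cvg_row.
  have bE : bl 0 i0 = (-1) ^+ b0.
    apply/esym/(cvg_unique _ _ (al_cvg i0)) => //.
    by apply: cvg_near_cst; apply: filterS al_i0 => p ->.
  by apply: contra_eqN bE => /eqP ->; rewrite mxE eq_sym signr_eq0.
near=> p.
have dp : 0 < d p by near: p.
have sep0 : dotrow (a p) (phin p x0) < dotrow (a p) (phin p e0).
  by near: p; exact: a_sep.
have sp x : Cop p [set` s] x ->
    dotrow (a p) (phin p x) <= dotrow (a p) (phin p x0).
  by apply: Cop_seq_le; near: p; exact: near_forall_seq.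
have tp x : Cop p [set` t] x ->
    dotrow (a p) (phin p e0) <= dotrow (a p) (phin p x).
  apply: Cop_seq_ge => e et; rewrite -lerN2; move: e et.
  by near: p; exact: near_forall_seq.
have inner_mono x y : dotrow (a p) (phin p x) <= dotrow (a p) (phin p y) ->
    inner_p p (al p) x <= inner_p p (al p) y.
  move=> xy; rewrite !innerE phi_inv_le phi_invK ler_wpM2l//.
  by rewrite invr_ge0 ltW.
split.
- have : al p 0 i0 = (-1) ^+ b0 by near: p.
  by apply: contra_eqN => /eqP ->; rewrite mxE eq_sym signr_eq0.
- apply/seteqP; split=> // x [/sp xs /tp xt].
  by have := lt_le_trans sep0 (le_trans xt xs); rewrite ltxx.
- by move=> x /sp; exact: inner_mono.
- by move=> x /tp xt; apply: inner_mono; exact: le_trans (ltW sep0) xt.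
Unshelve. all: by end_near. Qed.

Lemma convergent_separation_of_disjoint (R : realType) (n : nat)
  (A E : set 'rV[R]_n) : (0 < n)%N -> finite_set A -> finite_set E ->
  Coinfty A `&` Coinfty E = set0 -> convergent_separation A E.
Proof.
move=> n_gt0 finA finE disjAE.
have [A0|A0] := eqVneq A set0.
  by rewrite A0; exact: convergent_separation_set0l.
have [E0|E0] := eqVneq E set0.
  by rewrite E0; exact: convergent_separation_set0r.
have /finite_seqP[s As] := finA; have /finite_seqP[t Et] := finE.
have [meet|[a [ea a_sep]]] := meet_or_expsum_separation s t.
  have := @Coinfty_meet R n A E finA; rewrite As Et => /(_ meet).
  by rewrite -As -Et disjAE => /set0P/eqP.
rewrite As Et; apply: convergent_separation_of_expsum ea a_sep => //.
  by apply: contra_neq A0 => s0; rewrite As s0 set_nil.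
by apply: contra_neq E0 => t0; rewrite Et t0 set_nil.
Qed.

Theorem proposition4p2p1 (R : realType) (n : nat) (n_gt0 : (0 < n)%N)
  (A E : set 'rV[R]_n) (finA : finite_set A) (finE : finite_set E)
  (disjAE : Coinfty A `&` Coinfty E = set0) :
  (exists p0 : nat,
    (forall p : nat, (p0 <= p)%N -> Cop p A `&` Cop p E = set0) /\
    (forall p : nat, (p0 <= p)%N ->
      exists (a : 'rV[R]_n) (c : R),
        [/\ a != 0,
            Cop p A `<=` [set x | inner_p p a x <= c] &
            Cop p E `<=` [set x | inner_p p a x >= c]])) /\
  (exists (a : 'rV[R]_n) (c : R),
    [/\ a != 0,
        Coinfty A `<=` [set x | inner_minus a x <= c] &
        Coinfty E `<=` [set x | inner_plus a x >= c]]).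
Proof.
have [a [c [b [l [ab cl b0 sep]]]]] :=
  convergent_separation_of_disjoint n_gt0 finA finE disjAE.
split; last first.
  exists b, l; split => //.
    by apply: Ls_inner_minus_le ab cl _; apply: filterS sep => p [].
  by apply: Ls_inner_plus_ge ab cl _; apply: filterS sep => p [].
have [N _ sepN] := sep; exists N; split=> p /sepN[ap dAE Ap Ep] //.
by exists (a p), (c p).
Qed.
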